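(* Let $\Omega\subseteq\mathbb R^d$ be a non-empty open set. The space of generalized distributions $\widehat{\mathcal E}(\Omega)={}^*\mathcal E(\Omega)/J_{\mathcal D(\Omega)}$ can be embedded as a $\mathbb C$-vector subspace into the algebraic dual $\mathcal D^*(\Omega)$ of $\mathcal D(\Omega)$, i.e. there exists an injective $\mathbb C$-linear map $\widehat{\mathcal E}(\Omega)\to\mathcal D^*(\Omega)$.
   Context: The set-theoretic framework is ZFC together with the Generalized Continuum Hypothesis. $\mathcal E(\Omega)=\mathcal C^\infty(\Omega)$ (complex-valued smooth functions); $\mathcal D(\Omega)=\mathcal C_0^\infty(\Omega)$ (those with compact support); $\mathcal D^*(\Omega)$ is the space of all $\mathbb C$-linear functionals on $\mathcal D(\Omega)$. Let $\mathfrak c=\mathrm{card}\,\mathbb R$ and let $\mathfrak c_+$ be its successor cardinal. ${}^*\mathcal E(\Omega)$ is the non-standard extension of $\mathcal E(\Omega)$ in a $\mathfrak c_+$-saturated ultrapower non-standard model: concretely ${}^*\mathcal E(\Omega)=\mathcal E(\Omega)^I/\mathcal U$, where $I$ is an index set with $\mathrm{card}\,I=\mathfrak c$ and $\mathcal U$ is a $\mathfrak c_+$-good free (countably incomplete) ultrafilter on $I$. It is a $\mathbb C$-vector space in the obvious way. For $\varphi\in\mathcal D(\Omega)$, ${}^*\varphi$ is its non-standard extension (the class of the constant family). Define $$J_{\mathcal D(\Omega)}=\Big\{f\in{}^*\mathcal E(\Omega):\ \int_\Omega f(x)\,{}^*\varphi(x)\,dx=0\ \text{ for all }\varphi\in\mathcal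 D(\Omega)\Big\},$$ where the integral is the internal (non-standard) one: for $f$ represented by $(f_i)_{i\in I}$, the condition for $\varphi$ means $\{i\in I:\int_\Omega f_i(x)\varphi(x)\,dx=0\}\in\mathcal U$. $J_{\mathcal D(\Omega)}$ is a $\mathbb C$-linear subspace of ${}^*\mathcal E(\Omega)$. *)

(* Defs.v *)
From HB Require Import structures.
From mathcomp Require Import all_boot all_order all_algebra.
From mathcomp Require Import ring_quotient.
From mathcomp Require Import all_classical all_reals all_analysis.
From mathcomp Require Import measurable_realfun.
From mathcomp Require Import complex lra.
Import Order.TTheory GRing.Theory Num.Theory.
Import Quotient numFieldNormedType.Exports.

Set Implicit Arguments.
Unset Strict Implicit.
Unset Printing Implicit Defensive.

Local Open Scope classical_set_scope.
Local Open Scope ring_scope.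
Local Open Scope quotient_scope.
Local Open Scope card_scope.

Section QuotientSpace.
Variables (K : pzRingType) (V : lmodType K) (S : submodClosed V).

Let submod_opp : oppr_closed S.
Proof. by move=> x Sx; rewrite -scaleN1r rpredZ. Qed.

Definition zmod_of_submod : zmodClosed V :=
  HB.pack (GRing.SubmodClosed.sort S) (GRing.isOppClosed.Build V S submod_opp).

Definition quotmod : Type := {quot zmod_of_submod}.

HB.instance Definition _ := GRing.Zmodule.on quotmod.
HB.instance Definition _ := EqQuotient.on quotmod.

Definition quotmod_scale (a : K) : quotmod -> quotmod :=
  lift_op1 quotmod ( *:%R a).

Lemma pi_quotmodE (x y : V) : (\pi_quotmod x == \pi_quotmod y) = (x - y \in S).
Proof. exact/esym/(@idealrBE _ zmod_of_submod). Qed.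

Lemma pi_quotmod_scale a :
  {morph \pi_quotmod : x / a *: x >-> quotmod_scale a x}.
Proof.
move=> x; rewrite /quotmod_scale; unlock; apply/eqP.
by rewrite pi_quotmodE -scalerBr rpredZ // -pi_quotmodE reprK.
Qed.

Let pi_add : {morph \pi_quotmod : x y / x + y}.
Proof. exact: (@pi_add V zmod_of_submod). Qed.

Let scaleA a b v : quotmod_scale a (quotmod_scale b v) = quotmod_scale (a * b) v.
Proof. by rewrite -[v]reprK -!pi_quotmod_scale scalerA. Qed.

Let scale1 : left_id 1 quotmod_scale.
Proof. by move=> v; rewrite -[v]reprK -!pi_quotmod_scale scale1r. Qed.

Let scaleDr : right_distributive quotmod_scale +%R.
Proof.
move=> a u v; rewrite -[u]reprK -[v]reprK -pi_add -!pi_quotmod_scale scalerDr.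
by rewrite pi_add.
Qed.

Let scaleDl v : {morph quotmod_scale^~ v : a b / a + b}.
Proof.
by move=> a b; rewrite -[v]reprK -!pi_quotmod_scale scalerDl pi_add.
Qed.

HB.instance Definition _ := GRing.Zmodule_isLmodule.Build K quotmod
  scaleA scale1 scaleDr scaleDl.

Let pi_linear : linear (\pi_quotmod : V -> quotmod).
Proof. by move=> a u v; rewrite pi_add pi_quotmod_scale. Qed.

HB.instance Definition _ := GRing.isLinear.Build K V quotmod _
  (\pi_quotmod : V -> quotmod) pi_linear.

End QuotientSpace.

Section AlgebraicDual.
Variables (K : comNzRingType) (V : lmodType K).

Definition linear_forms : {pred V -> K^o} := fun f => `[< linear f >].

Let linear_forms_closed : submod_closed linear_forms.
Proof.
split=> [|b f g /asboolP hf /asboolP hg]; apply/asboolP => a u v.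
  by rewrite !scaler0 addr0.
rewrite !fctE hf hg !scalerDr !scalerA (mulrC b a) -!addrA.
by congr (_ + _); rewrite addrCA.
Qed.

HB.instance Definition _ := GRing.isSubmodClosed.Build K (V -> K^o)
  linear_forms linear_forms_closed.

(* The space of all K-linear functionals on V, without any continuity
   requirement; operations are pointwise. *)
Record alg_dual := AlgDual {
  alg_dual_fun :> V -> K^o;
  _ : alg_dual_fun \in linear_forms }.

HB.instance Definition _ := [isSub for alg_dual_fun].
HB.instance Definition _ := [Choice of alg_dual by <:].
HB.instance Definition _ := [SubChoice_isSubLmodule of alg_dual by <:].

End AlgebraicDual.

Section SmoothFunctions.
Variables (R : realType) (d : nat) (Omega : set 'rV[R]_d).

(* Real functions of class C^k on Omega, by iterated partial derivatives. The
   functions are total, but for an open Omega the values outside Omega are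
   irrelevant (see Ck_eq below). *)
Fixpoint Ck (k : nat) (f : 'rV[R]_d -> R) : Prop :=
  (forall x, Omega x -> {for x, continuous f}) /\
  (if k is k'.+1 then
     forall j : 'I_d,
       (forall x, Omega x -> derivable f x (delta_mx 0 j)) /\
       Ck k' (fun x => 'D_(delta_mx 0 j) f x)
   else True).

Definition smooth (f : 'rV[R]_d -> R[i]) : Prop :=
  forall k, Ck k (fun x => complex.Re (f x)) /\
            Ck k (fun x => complex.Im (f x)).

Hypothesis openO : open Omega.

Lemma near_open (P : set 'rV[R]_d) x :
  (forall y, Omega y -> P y) -> Omega x -> \forall y \near x, P y.
Proof.
move=> OP Ox; have : nbhs x Omega by exact: open_nbhs_nbhs.
by apply: filterS => y; exact: OP.
Qed.

Lemma Ck_eq k f g : (forall x, Omega x -> f x = g x) -> Ck k f -> Ck k g.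
Proof.
elim: k f g => [|k IH] f g fg.
  case=> cf _; split=> // x Ox; rewrite /prop_for /continuous_at -(fg x Ox).
  exact: (cvg_trans (near_eq_cvg (near_open fg Ox)) (cf x Ox)).
move=> [cf hf]; split.
  move=> x Ox; rewrite /prop_for /continuous_at -(fg x Ox).
  exact: (cvg_trans (near_eq_cvg (near_open fg Ox)) (cf x Ox)).
move=> j; have [df Df] := hf j; split.
- move=> x Ox; apply: near_eq_derivable (df x Ox).
  exact: (near_open fg Ox).
apply: IH Df => x Ox; apply: near_eq_derive.
exact: (near_open fg Ox).
Qed.

Lemma CkD k f g : Ck k f -> Ck k g -> Ck k (fun x => f x + g x).
Proof.
elim: k f g => [|k IH] f g /= [cf hf] [cg hg]; split=> //.
- by move=> x Ox; apply: continuousD; [exact: cf|exact: cg].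
- by move=> x Ox; apply: continuousD; [exact: cf|exact: cg].
move=> j; have [df Df] := hf j; have [dg Dg] := hg j; split.
  by move=> x Ox; apply: derivableD; [exact: df|exact: dg].
apply: Ck_eq (IH _ _ Df Dg) => x Ox.
by rewrite -deriveD; [|exact: df|exact: dg].
Qed.

Lemma CkZ k (a : R) f : Ck k f -> Ck k (fun x => a * f x).
Proof.
elim: k f => [|k IH] f /= [cf hf]; split=> //.
- by move=> x Ox; apply: continuousM; [exact: cst_continuous|exact: cf].
- by move=> x Ox; apply: continuousM; [exact: cst_continuous|exact: cf].
move=> j; have [df Df] := hf j; split.
  by move=> x Ox; apply: derivableZ; exact: df.
apply: Ck_eq (IH _ Df) => x Ox.
have := @deriveZ _ _ _ f a x (delta_mx 0 j) (df x Ox).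
by rewrite /GRing.scale/= => <-.
Qed.

Lemma Ck0 k : Ck k (fun=> 0).
Proof.
elim: k => [|k IH] /=; (split=> //; first by move=> x _; exact: cst_continuous).
move=> j; split=> [x _|]; first exact: derivable_cst.
by apply: Ck_eq IH => x _; rewrite derive_cst.
Qed.

(* A function on Omega is represented by its extension by zero to the whole
   space, so that equality of elements of smooth_fun is equality on Omega. The
   extension by zero is not required to be regular at the boundary. *)
Definition smooth_funs of open Omega : {pred 'rV[R]_d -> R[i]} :=
  fun f => `[< smooth f /\ forall x, ~ Omega x -> f x = 0 >].

Let smooth_funs_closed : submod_closed (smooth_funs openO).
Proof.
split=> [|a f g /asboolP[sf f0] /asboolP[sg g0]]; apply/asboolP; split.
- by move=> k; split; exact: Ck0.
- by [].
- move=> k; have [rf imf] := sf k; have [rg img] := sg k; split.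
  + have := CkD (CkD (CkZ (complex.Re a) rf) (CkZ (- complex.Im a) imf)) rg.
    apply: Ck_eq => x _; rewrite !fctE /GRing.scale/=.
    by case: a (f x) (g x) => [? ?] [? ?] [? ?] /=; rewrite mulNr.
  + have := CkD (CkD (CkZ (complex.Re a) imf) (CkZ (complex.Im a) rf)) img.
    apply: Ck_eq => x _; rewrite !fctE /GRing.scale/=.
    by case: a (f x) (g x) => [? ?] [? ?] [? ?] /=.
- by move=> x Ox; rewrite !fctE f0// g0// scaler0 addr0.
Qed.

HB.instance Definition _ := GRing.isSubmodClosed.Build R[i]
  ('rV[R]_d -> R[i]) (smooth_funs openO) smooth_funs_closed.

Record smooth_fun := SmoothFun {
  smooth_fun_fun :> 'rV[R]_d -> R[i];
  _ : smooth_fun_fun \in smooth_funs openO }.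

HB.instance Definition _ := [isSub for smooth_fun_fun].
HB.instance Definition _ := [Choice of smooth_fun by <:].
HB.instance Definition _ := [SubChoice_isSubLmodule of smooth_fun by <:].

Lemma smooth_funD a (f g : smooth_fun) x : (a *: f + g) x = a * f x + g x.
Proof. by []. Qed.

Definition supp (f : 'rV[R]_d -> R[i]) : set 'rV[R]_d :=
  closure [set x | f x != 0].

Definition test_funs : {pred smooth_fun} := fun f =>
  `[< compact (supp f) /\ supp f `<=` Omega >].

Let test_funs_closed : submod_closed test_funs.
Proof.
split=> [|a f g /asboolP[cf sf] /asboolP[cg sg]]; apply/asboolP.
  rewrite /supp (_ : [set x | _] = set0) ?closure0.
    by split; [exact: compact0|].
  by apply/seteqP; split=> x //=; rewrite eqxx.
have sub : supp (a *: f + g : smooth_fun) `<=` supp f `|` supp g.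
  rewrite /supp -closureU; apply: closure_subset => x /=.
  apply: contra_neqP => /not_orP[/negP]; rewrite negbK => /eqP fx /negP.
  rewrite negbK => /eqP gx.
  by rewrite [LHS](_ : _ = a * f x + g x)// fx gx mulr0 addr0.
split; last by move=> x /sub[/sf|/sg].
apply: (@subclosed_compact _ _ (supp f `|` supp g)) => //.
  exact: closed_closure.
exact: compactU.
Qed.

HB.instance Definition _ := GRing.isSubmodClosed.Build R[i]
  smooth_fun test_funs test_funs_closed.

Record test_fun := TestFun {
  test_fun_fun :> smooth_fun;
  _ : test_fun_fun \in test_funs }.

HB.instance Definition _ := [isSub for test_fun_fun].
HB.instance Definition _ := [Choice of test_fun by <:].
HB.instance Definition _ := [SubChoice_isSubLmodule of test_fun by <:].

End SmoothFunctions.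

Section LebesgueMeasure.
Variable R : realType.
Local Notation mR := (measurableTypeR R).

Definition cons_pair d (p : mR * d.-tuple mR) : d.+1.-tuple mR :=
  [tuple of p.1 :: p.2].

Let measurable_cons_pair d : measurable_fun setT (@cons_pair d).
Proof. exact: measurable_cons. Qed.

Section Step.
Variables (d : nat) (m : {sigma_finite_measure set (d.-tuple mR) -> \bar R}).

Definition lebesgue_step : set (d.+1.-tuple mR) -> \bar R :=
  pushforward (lebesgue_measure \x m)%E (@cons_pair d).

Let step0 : lebesgue_step set0 = 0%E.
Proof. by rewrite /lebesgue_step /pushforward preimage_set0 measure0. Qed.

Let step_ge0 A : (0 <= lebesgue_step A)%E.
Proof. exact: (@measure_ge0 _ _ _ (lebesgue_measure \x m)%E). Qed.

Let step_sigma_additive : semi_sigma_additive lebesgue_step.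
Proof.
have mF (F : (set (d.+1.-tuple mR))^nat) n : measurable (F n) ->
    measurable (@cons_pair d @^-1` F n).
  by move=> mFn; rewrite -[X in measurable X]setTI; exact: measurable_cons_pair.
move=> F mFn tF mUF; rewrite /lebesgue_step /pushforward preimage_bigcup.
apply: (@measure_semi_sigma_additive _ _ _ (lebesgue_measure \x m)%E).
- by move=> n; exact: mF.
- apply/trivIsetP => /= i j _ _ ij; rewrite -preimage_setI.
  by move/trivIsetP : tF => /(_ _ _ _ _ ij) ->//; rewrite preimage_set0.
- by rewrite -preimage_bigcup -[X in measurable X]setTI; exact: measurable_cons_pair.
Qed.

HB.instance Definition _ := isMeasure.Build _ _ _ lebesgue_step
  step0 step_ge0 step_sigma_additive.

Let step_sigma_finite : sigma_finite setT lebesgue_step.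
Proof.
have /sigma_finiteP[F [TF ndF Foo]] := sigma_finiteT (@lebesgue_measure R).
have /sigma_finiteP[G [TG ndG Goo]] := sigma_finiteT m.
pose s (t : d.+1.-tuple mR) : mR * d.-tuple mR := (thead t, [tuple of behead t]).
have ms : measurable_fun setT s.
  apply/measurable_fun_pair; last exact: measurable_behead.
  exact: measurable_tnth.
have sK p : s (cons_pair p) = p.
  by case: p => x t; rewrite /s /cons_pair /= theadE; congr pair; exact/val_inj.
exists (fun n => s @^-1` (F n `*` G n)).
  rewrite -preimage_bigcup (_ : \bigcup_n _ = setT)//; apply/seteqP; split=> //.
  move=> [x t] _; have [i _ Fx] : (\bigcup_n F n) x by rewrite -TF.
  have [j _ Gt] : (\bigcup_n G n) t by rewrite -TG.
  exists (maxn i j) => //; split=> /=.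
    by move: x Fx; exact/subsetPset/ndF/leq_maxl.
  by move: t Gt; exact/subsetPset/ndG/leq_maxr.
move=> n; have [mF Flty] := Foo n; have [mG Glty] := Goo n; split.
  by rewrite -[X in measurable X]setTI; apply: ms => //; exact: measurableX.
rewrite /lebesgue_step /pushforward (_ : _ @^-1` _ = F n `*` G n); last first.
  by apply/seteqP; split=> p; rewrite /preimage/mkset sK.
by rewrite product_measure1E// lte_mul_pinfty// ge0_fin_numE.
Qed.

HB.instance Definition _ := Measure_isSigmaFinite.Build _ _ _ lebesgue_step
  step_sigma_finite.

End Step.

(* d-dimensional Lebesgue measure, as the iterated product of the Lebesgue
   measure of the line: for the identification of d.+1-tuples with pairs,
   lebesgue_tuple d.+1 is lebesgue_measure \x lebesgue_tuple d. *)
Fixpoint lebesgue_tuple (d : nat) :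
    {sigma_finite_measure set (d.-tuple mR) -> \bar R} :=
  if d is d'.+1 then lebesgue_step (lebesgue_tuple d')
  else dirac ([tuple] : 0.-tuple mR).

End LebesgueMeasure.

Section Integral.
Variables (R : realType) (d : nat).
Local Notation mR := (measurableTypeR R).
Local Notation leb := (lebesgue_tuple R d).

Definition row_of_tuple (t : d.-tuple mR) : 'rV[R]_d := \row_i tnth t i.

(* The complex Lebesgue integral of f over D, for a measurable D. *)
Definition integralC (D : set 'rV[R]_d) (f : 'rV[R]_d -> R[i]) : R[i] :=
  ((\int[leb]_(t in row_of_tuple @^-1` D) complex.Re (f (row_of_tuple t)))
  +i*
  (\int[leb]_(t in row_of_tuple @^-1` D) complex.Im (f (row_of_tuple t))))%C.

Lemma measurable_row_ball (x : 'rV[R]_d) e : 0 < e ->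
  measurable (row_of_tuple @^-1` ball x e).
Proof.
move=> e0; rewrite (_ : _ @^-1` _ =
    \bigcap_(i in [set: 'I_d]) ((@tnth _ mR)^~ i @^-1` (ball (x 0 i) e : set R))).
  apply: fin_bigcap_measurable => // i _; rewrite -[X in measurable X]setTI.
  by apply: measurable_tnth => //; exact: open_measurable (ball_open _ _).
apply/seteqP; split=> t /=.
  by move=> [_ h] i _ /=; have := h 0 i; rewrite mxE.
by move=> h; split=> // j i; rewrite (ord1 j) mxE; exact: h.
Qed.

Lemma measurable_row_open (A : set 'rV[R]_d) : open A ->
  measurable (row_of_tuple @^-1` A).
Proof.
move=> oA.
pose c (q : 'rV[rat]_d) : 'rV[R]_d := map_mx ratr q.
pose B (p : 'rV[rat]_d * rat) : set 'rV[R]_d :=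
  [set x | [/\ 0 < ratr p.2 :> R, ball (c p.1) (ratr p.2) `<=` A &
     ball (c p.1) (ratr p.2) x]].
have -> : A = \bigcup_p B p.
  apply/seteqP; split=> [x Ax|x [p _ [_ sA /sA//]]].
  have /nbhs_ballP[e /= e0 xeA] : nbhs x A by exact: open_nbhs_nbhs.
  have [r] : exists r : rat, ratr r \in `]0, (e / 2) : R[.
    by apply: rat_in_itvoo; rewrite divr_gt0.
  rewrite in_itv/= => /andP[r0 re].
  have qP i : exists q : rat, (ratr q : R) \in `](x 0 i - ratr r), (x 0 i + ratr r)[.
    by apply: rat_in_itvoo; rewrite ltrBlDr -addrA ltrDl addr_gt0.
  pose q := \row_i projT1 (cid (qP i)).
  have qx : ball (c q) (ratr r) x.
    split=> // j i; rewrite (ord1 j) !mxE; case: cid => s /=.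
    by rewrite in_itv/= => h; rewrite /ball/= ltr_distlC; move: h; lra.
  exists (q, r) => //; split=> // y /= qy; apply: xeA.
  rewrite (splitr e); apply: (@le_ball _ _ _ (ratr r + ratr r)).
    by rewrite lerD// ltW.
  by apply: ball_triangle qy; exact: ball_sym.
rewrite preimage_bigcup; apply: countable_bigcupT_measurable.
  exact: countableP.
move=> p; have [[p0 sA]|np] := pselect (0 < ratr p.2 :> R /\
    ball (c p.1) (ratr p.2) `<=` A).
  rewrite (_ : B p = ball (c p.1) (ratr p.2)).
    exact: measurable_row_ball.
  by apply/seteqP; split=> x //= [].
rewrite (_ : B p = set0) ?preimage_set0//.
by apply/seteqP; split=> x //= -[p0 sA _]; apply: np.
Qed.

Lemma measurable_row_continuous (h : 'rV[R]_d -> R) : continuous h ->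
  measurable_fun setT (h \o row_of_tuple).
Proof.
move=> ch; apply: (measurability (@RGenOpens.G R)).
  exact: RGenOpens.measurableE.
move=> _ [_ [a [b ->]] <-]; rewrite setTI comp_preimage.
apply: measurable_row_open; move/continuousP: ch; apply.
exact: interval_open.
Qed.

End Integral.

Section Boxes.
Variable R : realType.
Local Notation mR := (measurableTypeR R).

Lemma lebesgue_tuple_box d (M : R) :
  measurable [set t : d.-tuple mR | forall i, `|tnth t i| <= M] /\
  (lebesgue_tuple R d [set t | forall i, (`|tnth t i| <= M)%R] < +oo)%E.
Proof.
have IE : [set x : mR | `|x| <= M] = `[- M, M]%classic.
  by apply/seteqP; split=> x /=; rewrite in_itv/= ler_norml.
have mI : measurable ([set x | `|x| <= M] : set mR).
  by rewrite IE; exact: measurable_itv.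
have mbox n : measurable [set t : n.-tuple mR | forall i, `|tnth t i| <= M].
  rewrite (_ : mkset _ =
     \bigcap_(i in [set: 'I_n]) ((@tnth _ mR)^~ i @^-1` [set x | `|x| <= M])).
    apply: fin_bigcap_measurable => // i _; rewrite -[X in measurable X]setTI.
    exact: measurable_tnth.
  by apply/seteqP; split=> t /= h i; [move=> _|]; exact: h.
split; first exact: mbox.
elim: d => [|d IH] /=.
  by rewrite diracE ltry.
pose s (t : d.+1.-tuple mR) : mR * d.-tuple mR := (thead t, [tuple of behead t]).
have sK p : s (cons_pair p) = p.
  by case: p => x t; rewrite /s /cons_pair /= theadE; congr pair; exact/val_inj.
pose B := [set x : mR | `|x| <= M] `*`
  [set t : d.-tuple mR | forall i, `|tnth t i| <= M].
have -> : [set t : d.+1.-tuple mR | forall i, `|tnth t i| <= M] =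
    s @^-1` B.
  have bt (t : d.+1.-tuple mR) i :
      tnth t (lift ord0 i) = tnth [tuple of behead t] i.
    by rewrite [in LHS](tuple_eta t) tnthS.
  apply/seteqP; split=> t /=.
    by move=> h; split=> [|i] /=; [exact: (h ord0)|rewrite -bt; exact: h].
  move=> [/= h0 h] i; case: (unliftP ord0 i) => [j ->|->]; last exact: h0.
  by rewrite bt; exact: h.
rewrite /lebesgue_step /pushforward (_ : _ @^-1` _ = B); last first.
  by apply/seteqP; split=> p; rewrite /preimage/mkset sK.
have Ioo : (@lebesgue_measure R [set x | (`|x| <= M)%R] < +oo)%E.
  rewrite IE lebesgue_measure_itv/=; case: ifPn => // _.
  by rewrite -EFinD ltry.
rewrite /B product_measure1E//; last exact: mbox.
by rewrite lte_mul_pinfty// ge0_fin_numE.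
Qed.

End Boxes.
Section Pairing.
Variables (R : realType) (d : nat) (Omega : set 'rV[R]_d) (openO : open Omega).
Local Notation mR := (measurableTypeR R).
Local Notation leb := (lebesgue_tuple R d).

(* The integrand is integrable, see pairing_integrable below. *)
Definition pairing (f : smooth_fun openO) (phi : test_fun openO) : R[i] :=
  integralC Omega (fun x => f x * phi x).

Let compact_support_integrable (K : set 'rV[R]_d) (h : 'rV[R]_d -> R) :
  compact K -> (forall x, ~ K x -> h x = 0) -> continuous h ->
  leb.-integrable (@row_of_tuple R d @^-1` Omega)
    (EFin \o (fun t => h (row_of_tuple t))).
Proof.
move=> cK hK ch; have mh := measurable_row_continuous ch.
have [M KM] : exists M, forall x, K x -> forall i, `|x 0 i| <= M.
  have [M [Mr /(_ (M + 1))]] := compact_bounded cK.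
  rewrite ltrDl ltr01 => /(_ isT) KM; exists (M + 1) => x Kx i.
  apply: le_trans (KM _ Kx); rewrite [leRHS]/Num.norm/= mx_normrE.
  exact: (le_bigmax _ (fun ij => `|x ij.1 ij.2|) (0, i)).
have [B hB] : exists B, forall x, `|h x| <= B.
  have /compact_bounded[B [Br /(_ (B + 1))]] : compact (h @` K).
    by apply: continuous_compact cK; exact: continuous_subspaceT.
  rewrite ltrDl ltr01 => /(_ isT) KB; exists (Num.max 0 (B + 1)) => x.
  have [Kx|nKx] := pselect (K x); last by rewrite hK// normr0 le_max lexx.
  by rewrite le_max; apply/orP; right; apply: KB; exists x.
have [mbox boxoo] := lebesgue_tuple_box d M.
set box := mkset _ in mbox boxoo.
apply: (@integrableS _ _ _ _ setT) => //; first exact: measurable_row_open.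
rewrite (_ : _ \o _ = (EFin \o (fun t => h (row_of_tuple t))) \_ box).
  have : leb.-integrable box (EFin \o (h \o @row_of_tuple R d)).
    apply: (measurable_bounded_integrable mbox boxoo).
      exact: measurable_funS mh.
    exists B; split; first exact: num_real.
    by move=> C BC t _ /=; rewrite (le_trans (hB _))// ltW.
  by move/(integrable_mkcond _ mbox).
apply/funext => t; rewrite patchE; case: ifPn => //= /negP tbox.
rewrite hK// => Kt; apply: tbox; rewrite inE => i.
by have := KM _ Kt i; rewrite mxE.
Qed.

Lemma smooth_fun_continuous (f : smooth_fun openO) x : Omega x ->
  {for x, continuous (fun y => complex.Re (f y))} /\
  {for x, continuous (fun y => complex.Im (f y))}.
Proof.
move=> Ox; have /asboolP[/(_ 0%N) [[cr _] [ci _]] _] := valP f.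
by split; [exact: cr|exact: ci].
Qed.

Lemma pairing_integrable (f : smooth_fun openO) (phi : test_fun openO) :
  leb.-integrable (@row_of_tuple R d @^-1` Omega)
    (EFin \o (fun t => complex.Re (f (row_of_tuple t) * phi (row_of_tuple t)))) /\
  leb.-integrable (@row_of_tuple R d @^-1` Omega)
    (EFin \o (fun t => complex.Im (f (row_of_tuple t) * phi (row_of_tuple t)))).
Proof.
have /asboolP[cK KO] := valP phi.
set K := supp _ in cK KO.
have phiK x : ~ K x -> phi x = 0.
  by move=> nKx; apply: contra_notP nKx => /eqP ?; exact: subset_closure.
pose hr (x : 'rV[R]_d) := complex.Re (f x * phi x).
pose hi (x : 'rV[R]_d) := complex.Im (f x * phi x).
have hrE x : hr x = complex.Re (f x) * complex.Re (phi x)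
                  - complex.Im (f x) * complex.Im (phi x).
  by rewrite /hr; case: (f x) => ? ?; case: (smooth_fun_fun _ x).
have hiE x : hi x = complex.Re (f x) * complex.Im (phi x)
                  + complex.Im (f x) * complex.Re (phi x).
  by rewrite /hi; case: (f x) => ? ?; case: (smooth_fun_fun _ x).
have near0 (h : 'rV[R]_d -> R) x : (forall y, ~ K y -> h y = 0) ->
    ~ Omega x -> {for x, continuous h}.
  move=> h0 nOx; have nKx : ~ K x by move/KO.
  have : \forall y \near x, 0 = h y.
    have : nbhs x (~` K).
      by apply: open_nbhs_nbhs; split=> //; apply/closed_openC/closed_closure.
    by apply: filterS => y /h0.
  move=> hn; rewrite /prop_for /continuous_at (h0 x nKx).
  exact: (cvg_trans (near_eq_cvg hn) (cvg_cst _)).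
split; [apply: (@compact_support_integrable K hr cK) => //|
  apply: (@compact_support_integrable K hi cK) => //].
- by move=> x /phiK phix; rewrite /hr /hi phix mulr0.
- move=> x; have [Ox|nOx] := pselect (Omega x); last first.
    by apply: (near0 hr _ _ nOx) => y /phiK phiy; rewrite /hr phiy mulr0.
  have [fr fi] := smooth_fun_continuous f Ox.
  have [pr pi] := smooth_fun_continuous phi Ox.
  rewrite (funext hrE).
  exact: (continuousB (continuousM fr pr) (continuousM fi pi)).
- by move=> x /phiK phix; rewrite /hr /hi phix mulr0.
- move=> x; have [Ox|nOx] := pselect (Omega x); last first.
    by apply: (near0 hi _ _ nOx) => y /phiK phiy; rewrite /hi phiy mulr0.
  have [fr fi] := smooth_fun_continuous f Ox.
  have [pr pi] := smooth_fun_continuous phi Ox.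
  rewrite (funext hiE).
  exact: (continuousD (continuousM fr pi) (continuousM fi pr)).
Qed.

Lemma pairing_linear (phi : test_fun openO) (a : R[i]) (f g : smooth_fun openO) :
  pairing (a *: f + g) phi = a * pairing f phi + pairing g phi.
Proof.
have [fr fi] := pairing_integrable f phi.
have [gr gi] := pairing_integrable g phi.
have mO := measurable_row_open openO.
set D := _ @^-1` _ in mO.
have ZI (c : R) (h : d.-tuple mR -> R) : leb.-integrable D (EFin \o h) ->
    leb.-integrable D (EFin \o (fun t => c * h t)).
  move=> hI; rewrite (_ : _ \o _ = (fun t => c%:E * (EFin \o h) t)%E).
    exact: integrableZl.
  by apply/funext => t /=; rewrite EFinM.
have DI (h k : d.-tuple mR -> R) : leb.-integrable D (EFin \o h) ->
    leb.-integrable D (EFin \o k) ->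
    leb.-integrable D (EFin \o (fun t => h t + k t)).
  move=> hI kI; rewrite (_ : _ \o _ = (EFin \o h) \+ (EFin \o k))%E//.
  exact: integrableD.
case: a => ar ai; rewrite /pairing /integralC.
pose F1 t := complex.Re (f (@row_of_tuple R d t) * phi (@row_of_tuple R d t)).
pose F2 t := complex.Im (f (@row_of_tuple R d t) * phi (@row_of_tuple R d t)).
pose G1 t := complex.Re (g (@row_of_tuple R d t) * phi (@row_of_tuple R d t)).
pose G2 t := complex.Im (g (@row_of_tuple R d t) * phi (@row_of_tuple R d t)).
have -> : \int[leb]_(t in D) complex.Re (((ar +i* ai)%C *: f + g)
      (row_of_tuple t) * phi (row_of_tuple t)) =
    \int[leb]_(t in D) (ar * F1 t + - ai * F2 t + G1 t).
  apply: eq_Rintegral => t _; rewrite /F1 /F2 /G1 smooth_funD mulrDl -mulrA.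
  by case: (f _ * _) => ? ?; case: (g _ * _) => ? ? /=; rewrite mulNr.
have -> : \int[leb]_(t in D) complex.Im (((ar +i* ai)%C *: f + g)
      (row_of_tuple t) * phi (row_of_tuple t)) =
    \int[leb]_(t in D) (ar * F2 t + ai * F1 t + G2 t).
  apply: eq_Rintegral => t _; rewrite /F1 /F2 /G2 smooth_funD mulrDl -mulrA.
  by case: (f _ * _) => ? ?; case: (g _ * _) => ? ? /=.
rewrite !RintegralD ?RintegralZl//; try by repeat (apply: DI || apply: ZI).
by apply/eqP; rewrite eq_complex /= mulNr !eqxx.
Qed.

End Pairing.

Section Ultrapower.
Variables (K : pzRingType) (V : lmodType K) (I : Type) (U : set_system I).
Context {FU : Filter U}.

(* Quotienting V^I by the families that vanish U-almost everywhere amounts to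
   identifying families that agree U-almost everywhere, see ultrapowerP. *)
Definition null_families of Filter U : {pred I -> V} :=
  fun F => `[< U [set i | F i = 0] >].

Let null_families_closed : submod_closed (null_families FU).
Proof.
split=> [|a F G /asboolP F0 /asboolP G0]; apply/asboolP.
  by apply: filterS filterT => i.
by apply: filterS2 F0 G0 => i /= F0 G0; rewrite !fctE F0 G0 scaler0 addr0.
Qed.

HB.instance Definition _ := GRing.isSubmodClosed.Build K (I -> V)
  (null_families FU) null_families_closed.

Definition ultrapower : Type := quotmod (null_families FU).

HB.instance Definition _ := GRing.Lmodule.on ultrapower.
HB.instance Definition _ := EqQuotient.on ultrapower.

Lemma pi_ultrapower_linear a (F G : I -> V) :
  \pi_ultrapower (a *: F + G) = a *: \pi_ultrapower F + \pi_ultrapower G.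
Proof.
exact: (linearP (\pi_(quotmod (null_families FU)) :
  {linear (I -> V) -> quotmod (null_families FU)})).
Qed.

Lemma ultrapowerP (F G : I -> V) :
  \pi_ultrapower F = \pi_ultrapower G <-> U [set i | F i = G i].
Proof.
have E : (\pi_ultrapower F == \pi_ultrapower G) = (F - G \in null_families FU).
  exact: pi_quotmodE.
split=> [/eqP|UFG].
  rewrite E => /asboolP; apply: filterS => i /= /eqP.
  by rewrite !fctE subr_eq0 => /eqP.
apply/eqP; rewrite E; apply/asboolP; apply: filterS UFG => i /=.
by rewrite !fctE => ->; rewrite subrr.
Qed.

End Ultrapower.
Arguments ultrapower {K} V {I} U {FU}.

Section GeneralizedDistributions.
Variables (R : realType) (d : nat) (Omega : set 'rV[R]_d) (openO : open Omega).
Variables (I : Type) (U : set_system I).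
Context {FU : Filter U}.

Local Notation E := (smooth_fun openO).
Local Notation D := (test_fun openO).

(* The internal integral of the product of f with the extension of phi is zero.
   The condition does not depend on the representative of f, see J_testP. *)
Definition J_test : {pred ultrapower E U} := fun f =>
  `[< forall phi : D, U [set i | pairing (repr f i) phi = 0] >].

Lemma J_testP (F : I -> E) :
  reflect (forall phi : D, U [set i | pairing (F i) phi = 0])
          (\pi_(ultrapower E U) F \in J_test).
Proof.
have UF : U [set i | repr (\pi_(ultrapower E U) F) i = F i].
  by apply/ultrapowerP; rewrite reprK.
apply: (iffP (asboolP _)) => h phi; apply: filterS2 UF (h phi) => i /=.
  by move=> ->.
by move=> ->.
Qed.

Let J_test_closed : submod_closed J_test.
Proof.
have piL a (F G : I -> E) : \pi_(ultrapower E U) (a *: F + G) =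
    a *: \pi_(ultrapower E U) F + \pi_(ultrapower E U) G.
  exact: pi_ultrapower_linear.
split=> [|a f g].
  have -> : 0 = \pi_(ultrapower E U) (0 : I -> E).
    by have := piL (-1) 0 0; rewrite scaler0 addr0 scaleN1r addNr => ->.
  apply/J_testP => phi; apply: filterS filterT => i _ /=.
  have := pairing_linear phi (-1) (0 : E) 0.
  by rewrite scaler0 addr0 mulN1r addNr.
rewrite -[f]reprK -[g]reprK -piL => /J_testP Jf /J_testP Jg.
apply/J_testP => phi; apply: filterS2 (Jf phi) (Jg phi) => i /= fi gi.
by rewrite pairing_linear fi gi mulr0 addr0.
Qed.

HB.instance Definition _ := GRing.isSubmodClosed.Build R[i]
  (ultrapower E U) J_test J_test_closed.

Definition gen_distribution : Type := quotmod J_test.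

HB.instance Definition _ := GRing.Lmodule.on gen_distribution.
HB.instance Definition _ := EqQuotient.on gen_distribution.

End GeneralizedDistributions.
Arguments gen_distribution {R d Omega} openO {I} U {FU}.

Definition card_lt (T T' : Type) : Prop :=
  [set: T] #<= [set: T'] /\ ~ ([set: T'] #<= [set: T]).

(* For an infinite T, no cardinal lies strictly between T and its power set;
   set T is T -> Prop. *)
Definition GCH : Prop := forall T T' : Type, infinite_set [set: T] ->
  ~ (card_lt T T' /\ card_lt T' (set T)).

(* The cardinal of T' is the least one greater than that of T. *)
Definition successor_cardinal (T T' : Type) : Prop :=
  card_lt T T' /\ forall S : Type, card_lt T S -> [set: T'] #<= [set: S].

Definition countably_incomplete (I : Type) (U : set_system I) : Prop :=
  exists A : nat -> set I, (forall n, U (A n)) /\ \bigcap_n A n = set0.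

Definition free_filter (I : Type) (U : set_system I) : Prop :=
  \bigcap_(A in U) A = set0.

(* kappa-goodness in the sense of Keisler, kappa being the cardinal of K: for
   every cardinal lambda < kappa, every monotone (inclusion-reversing) map from
   the finite subsets of lambda to U is refined by a multiplicative one. *)
Definition good_filter (K I : Type) (U : set_system I) : Prop :=
  forall L : Type, card_lt L K ->
  forall f : set L -> set I,
    (forall S, finite_set S -> U (f S)) ->
    (forall S T, finite_set S -> finite_set T -> S `<=` T -> f T `<=` f S) ->
  exists g : set L -> set I,
    [/\ forall S, finite_set S -> U (g S),
        forall S, finite_set S -> g S `<=` f S &
        forall S T, finite_set S -> finite_set T -> g (S `|` T) = g S `&` g T].

(* Main.v *)
From HB Require Import structures.
Require Import Defs.
From mathcomp Require Import all_boot all_order all_algebra.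
From mathcomp Require Import all_classical all_reals all_analysis.
From mathcomp Require Import complex.
From mathcomp Require Import lra ring.
Import Order.TTheory GRing.Theory Num.Theory.
Import numFieldNormedType.Exports.

Set Implicit Arguments.
Unset Strict Implicit.
Unset Printing Implicit Defensive.

Local Open Scope classical_set_scope.
Local Open Scope ring_scope.
Local Open Scope card_scope.

(* The embedding comes from a comparison of dimensions. A smooth function is
   determined by its values at rational points, hence by a subset of a
   countable set Q, so a generalized distribution is determined by a subset of
   T := I * Q, where I has the cardinality of R. On the other hand the finite
   sequences over T * bool can be coded by real numbers, and bump functions with
   pairwise distinct radii around a common center are linearly independent.
   Viewing a sequence over T * bool as a list of conditions t \in S or
   t \notin S, the functionals on test functions that send the bump of l to 1 if
   S satisfies l and to 0 otherwise are linearly independent when S ranges over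
   the subsets of T. Mapping a Hamel basis of the generalized distributions to
   these functionals gives the injection. *)

(** * Hamel bases and linear extension *)

Section HamelBasis.
Variables (K : fieldType) (V : lmodType K).

Definition free_set (S : set V) := forall (s : seq V) (c : V -> K),
  uniq s -> (forall x, x \in s -> S x) -> \sum_(x <- s) c x *: x = 0 ->
  forall x, x \in s -> c x = 0.

(** Coefficients vanish off the list, so that coordinates over different lists can be compared over
    a longer common list. *)
Definition coordinates (S : set V) (w : V) (sc : seq V * (V -> K)) :=
  [/\ uniq sc.1, forall x, x \in sc.1 -> S x,
      forall x, x \notin sc.1 -> sc.2 x = 0 & w = \sum_(x <- sc.1) sc.2 x *: x].

Lemma big_zero_out (T : eqType) (W : lmodType K) (s t : seq T)
    (c : T -> K) (h : T -> W) : uniq s -> uniq t -> {subset s <= t} ->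
  (forall x, x \notin s -> c x = 0) ->
  \sum_(x <- s) c x *: h x = \sum_(x <- t) c x *: h x.
Proof.
move=> us ut st c0; rewrite [RHS](bigID (mem s)) /= [X in _ + X]big1 ?addr0.
  rewrite -[RHS]big_filter; apply: perm_big; apply: uniq_perm => //.
    exact: filter_uniq.
  move=> x; rewrite mem_filter; case: (boolP (x \in s)) => // xs.
  by rewrite (st _ xs).
by move=> x xs; rewrite c0 ?scale0r.
Qed.

(** Zorn's lemma runs over the sets to be added to [S], so that the empty chain is covered by the
    freeness of [S]. *)
Lemma free_set_maximal (S : set V) : free_set S ->
  exists B, [/\ S `<=` B, free_set B & forall w, exists sc, coordinates B w sc].
Proof.
move=> freeS; pose P (A : set V) := free_set (S `|` A).
have [F FP tF|A [PA maxA]] := @Zorn_bigcup V P.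
  move=> s c us sF; suff [A PA sA] : exists2 A, P A &
      forall x, x \in s -> (S `|` A) x by exact: PA.
  have [F0|/set0P[A0 FA0]] := eqVneq F set0.
    exists set0; first by rewrite /P setU0.
    by move: sF; rewrite F0 bigcup_set0.
  (* A finite list has all its elements in [S] or in a single member of the chain. *)
  suff [A FA sA] : exists2 A, F A & forall x, x \in s -> (S `|` A) x.
    by exists A => //; exact: FP.
  elim: s {us} sF => [|x s IH] sF; first by exists A0.
  have [y ys|A FA sA] := IH; first by apply: sF; rewrite inE ys orbT.
  have [Sx|[A' FA' A'x]] := sF x (mem_head _ _).
    by exists A => // y; rewrite inE => /predU1P[->|/sA//]; left.
  have [AA'|A'A] := tF _ _ FA FA'.
    by exists A' => // y; rewrite inE => /predU1P[->|/sA[?|/AA' ?]];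
      [right|left|right].
  by exists A => // y; rewrite inE => /predU1P[->|/sA//]; right; exact: A'A.
exists (S `|` A); split=> //.
move=> w; have [Bw|nBw] := pselect ((S `|` A) w).
  exists ([:: w], fun x => (x == w)%:R); split=> //=.
  - by move=> x; rewrite inE => /eqP ->.
  - by move=> x; rewrite inE => /negPf ->.
  - by rewrite big_seq1 eqxx scale1r.
(* Adding [w] to the maximal set creates a nontrivial relation; [w] occurs in it with nonzero
   coefficient, so it can be solved for [w]. *)
have /existsNP[s /existsNP[c /not_implyP[us /not_implyP[sB]]]] :
    ~ P (A `|` [set w]).
  apply: maxA; split; first by move=> x Sx; left.
  by move=> /(_ w) /= h; apply: nBw; right; apply: h; right.
move=> /not_implyP[s0 /existsNP[x /not_implyP[xs cx]]].
have sA y : y \in s -> y != w -> (S `|` A) y.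
  by move=> /sB[|[|-> /eqP//]]; [left|right].
have ws : w \in s.
  apply: contrapT => /negP nws; apply: cx; move: x xs; apply: (PA s c) => //.
  by move=> y ys; apply: sA => //; apply: contraNneq nws => <-.
rewrite (bigD1_seq w) //= -big_filter in s0.
set t := [seq y <- s | y != w] in s0.
have ut : uniq t by exact: filter_uniq.
have tB y : y \in t -> (S `|` A) y.
  by rewrite mem_filter => /andP[yw /sA]; exact.
have cw : c w != 0.
  apply/eqP => cw; rewrite cw scale0r add0r in s0.
  case: (eqVneq x w) => [xw|xw]; first by rewrite xw in cx.
  by apply: cx; apply: (PA t c) => //; rewrite mem_filter xw.
exists (t, fun y => if y \in t then - (c w)^-1 * c y else 0); split=> //=.
  by move=> y /negPf ->.
move/eqP: s0; rewrite addr_eq0 => /eqP s0.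
rewrite -[LHS](scalerK cw) s0 scalerN -scaleNr scaler_sumr big_seq [RHS]big_seq.
by apply: eq_bigr => y ->; rewrite scalerA.
Qed.

(** Over a common list, freeness forces the coefficients of [w] to be [a] times those of [u] plus
    those of [v]. Hence extending [g] by coordinates is linear, whatever coordinates are chosen. *)
Lemma coordinates_unique (S : set V) : free_set S ->
  forall (W : lmodType K) (g : V -> W) a u v w su sv sw,
  coordinates S u su -> coordinates S v sv -> coordinates S w sw ->
  w = a *: u + v ->
  \sum_(x <- sw.1) sw.2 x *: g x =
  a *: (\sum_(x <- su.1) su.2 x *: g x) + \sum_(x <- sv.1) sv.2 x *: g x.
Proof.
move=> freeS W g a u v w [s c] [s' c'] [s'' c''] [/= us sS c0 uE].
move=> [/= us' sS' c0' vE] [/= us'' sS'' c0'' wE] E.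
pose t := undup (s ++ s' ++ s'').
have ut : uniq t by exact: undup_uniq.
have st : {subset s <= t} by move=> x xs; rewrite mem_undup !mem_cat xs.
have st' : {subset s' <= t} by move=> x xs; rewrite mem_undup !mem_cat xs orbT.
have st'' : {subset s'' <= t}.
  by move=> x xs; rewrite mem_undup !mem_cat xs !orbT.
have tS x : x \in t -> S x.
  by rewrite mem_undup !mem_cat => /or3P[/sS|/sS'|/sS''].
have dE (W' : lmodType K) (h : V -> W') :
    \sum_(x <- t) (c'' x - (a * c x + c' x)) *: h x =
    \sum_(x <- s'') c'' x *: h x -
    (a *: (\sum_(x <- s) c x *: h x) + \sum_(x <- s') c' x *: h x).
  rewrite (big_zero_out h us ut)// (big_zero_out h us' ut)//.
  rewrite (big_zero_out h us'' ut)// scaler_sumr -big_split -sumrB /=.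
  by apply: eq_bigr => x _; rewrite scalerBl scalerDl scalerA.
apply/eqP; rewrite -subr_eq0 -dE big_seq big1// => x xt.
rewrite (freeS t (fun x => c'' x - (a * c x + c' x)))// ?scale0r//.
by rewrite dE -wE -uE -vE E subrr.
Qed.

Lemma linear_extension (S : set V) (W : lmodType K) (g : V -> W) :
  free_set S -> exists F : {linear V -> W}, forall x, S x -> F x = g x.
Proof.
move=> /free_set_maximal[B [SB freeB spanB]].
pose sc w := projT1 (cid (spanB w)).
have scP w : coordinates B w (sc w) by exact: projT2 (cid (spanB w)).
pose F w := \sum_(x <- (sc w).1) (sc w).2 x *: g x.
have Flin : linear F by move=> a u v; exact: (coordinates_unique freeB).
pose FL := GRing.isLinear.Build K V W _ F Flin.
exists (HB.pack_for {linear V -> W} F FL) => x /SB Bx /=.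
have xP : coordinates B x ([:: x], fun y => (y == x)%:R).
  split=> //=.
  - by move=> y; rewrite inE => /eqP ->.
  - by move=> y; rewrite inE => /negPf ->.
  - by rewrite big_seq1 eqxx scale1r.
(* The coordinates chosen for [x] may differ from the singleton [xP]; computing the value at [x + x]
   in two ways and cancelling [F x] identifies their images. *)
have := coordinates_unique freeB g (scP x) xP (scP ((1 + 1) *: x)).
move=> /(_ 1); rewrite scalerDl !scale1r => /(_ erefl).
have := coordinates_unique freeB g (scP x) (scP x) (scP ((1 + 1) *: x)).
move=> /(_ 1); rewrite scalerDl !scale1r => /(_ erefl) -> /addrI.
by rewrite -/(F x) => ->; rewrite /= big_seq1 eqxx scale1r.
Qed.

End HamelBasis.

(** * Indexed free families and the injections they induce *)

Definition free_family (K : fieldType) (V : lmodType K) (J : choiceType)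
    (v : J -> V) := forall (s : seq J) (c : J -> K), uniq s ->
  \sum_(j <- s) c j *: v j = 0 -> forall j, j \in s -> c j = 0.

Section FreeFamilies.
Variables (K : fieldType) (V : lmodType K).

Lemma free_family_inj (J : choiceType) (v : J -> V) :
  free_family v -> injective v.
Proof.
move=> freev i j vij; apply: contrapT => /eqP ij.
have := freev [:: i; j] (fun k => if k == i then 1 else -1).
rewrite big_cons big_seq1 eqxx eq_sym (negPf ij) vij scale1r scaleN1r subrr /=.
rewrite !inE ij => /(_ isT erefl i); rewrite !inE eqxx => /(_ isT)/eqP.
by rewrite oner_eq0.
Qed.

Lemma free_family_range (J : choiceType) (v : J -> V) :
  free_family v -> free_set (range v).
Proof.
move=> freev s c us sv s0 x xs.
have [j _ _] := sv x xs.
pose r x := xget j [set i | v i = x].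
have vK : {in s, cancel r v}.
  rewrite /r; move=> y ys; case: xgetP => [i _ //|] /=.
  by have [i _ <-] := sv y ys; move=> /(_ i) /=.
have /(_ (map r s) (c \o v)) := freev.
rewrite map_inj_in_uniq//; last exact: can_in_inj vK.
move=> /(_ us); rewrite big_map => h.
rewrite -[x]vK//; apply: h; last exact: map_f.
by rewrite -[RHS]s0 [RHS]big_seq big_seq; apply: eq_bigr => y ys /=; rewrite vK.
Qed.

Lemma linear_extension_family (J : choiceType) (v : J -> V) (W : lmodType K)
    (g : J -> W) : free_family v ->
  exists F : {linear V -> W}, forall j, F (v j) = g j.
Proof.
move=> freev; have freeS := free_family_range freev.
(* [xget] needs a default index, so the empty family is treated apart. *)
have [[j0 _]|/set0P/negP] := pselect ([set: J] !=set0); last first.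
  rewrite negbK => /eqP J0; exists \0 => j.
  by have : [set: J] j by []; rewrite J0.
have [F FE] := linear_extension (fun x => g (xget j0 [set i | v i = x])) freeS.
exists F => j; rewrite FE; last by exists j.
congr g; case: xgetP => [i _|/(_ j)] //=; exact: free_family_inj.
Qed.

End FreeFamilies.

(** A Hamel basis of [V] is a subset of [V], so a free family indexed by all of [V] supplies
    independent images for it, and no cardinality of a basis has to be computed. *)
Lemma linear_injection (K : fieldType) (V W : lmodType K) (v : V -> W) :
  free_family v -> exists F : {linear V -> W}, injective F.
Proof.
move=> freev; have free0 : free_set (set0 : set V) by move=> s c _ s0 _ x /s0.
have [B [_ freeB spanB]] := free_set_maximal free0.
have [F FE] := linear_extension v freeB.
exists F; suff ker0 w : F w = 0 -> w = 0 by exact: raddf_inj.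
move=> Fw0.
have [[s c] [/= us sB c0 wE]] := spanB w.
rewrite wE big_seq big1// => x xs. rewrite (freev s c)// ?scale0r//.
rewrite -[RHS]Fw0 wE linear_sum big_seq [RHS]big_seq.
by apply: eq_bigr => y ys; rewrite linearZ /= FE//; exact: sB.
Qed.

(** * Bump functions *)

Section FlatExp.
Variable R : realType.

(** The factor [t ^- n] makes the family stable under differentiation up to linear combinations, so
    smoothness follows by induction. *)
Definition flat_exp (n : nat) (t : R) : R :=
  if 0 < t then t ^- n * expR (- t^-1) else 0.

Lemma flat_exp_ge0 n t : 0 <= flat_exp n t.
Proof.
rewrite /flat_exp; case: ifPn => // t0.
by rewrite mulr_ge0 ?expR_ge0// invr_ge0 exprn_ge0// ltW.
Qed.

Lemma flat_exp_gt0 n t : (0 < flat_exp n t) = (0 < t).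
Proof.
rewrite /flat_exp; case: ifPn => [t0|]; last by rewrite ltxx.
by rewrite mulr_gt0 ?expR_gt0// invr_gt0 exprn_gt0.
Qed.

(** With s = 1/t for t > 0, this is s^n / n! <= e^s. *)
Lemma flat_exp_le_fact n t : flat_exp n t <= n`!%:R.
Proof.
rewrite /flat_exp; case: ifPn => // t0.
have ti0 : 0 <= t^-1 by rewrite invr_ge0 ltW.
rewrite expRN ler_pdivrMr ?expR_gt0// -exprVn.
rewrite mulrC -ler_pdivrMr ?ltr0n ?fact_gt0//.
case: n => [|n]; first by rewrite expr0 divr1 (le_trans _ (expR_ge1Dx _))// lerDl.
by apply: le_trans (expR_ge1Dxn n ti0); rewrite lerDr.
Qed.

(** [flat_exp n t] is t^2 times the bounded [flat_exp n.+2 t]. The quadratic bound makes the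
    derivative at 0 vanish. *)
Lemma flat_exp_quadratic n t : flat_exp n t <= n.+2`!%:R * t ^+ 2.
Proof.
have [t0|t0] := ltP 0 t; last first.
  by rewrite /flat_exp ltNge t0 /= mulr_ge0// sqr_ge0.
have -> : flat_exp n t = flat_exp n.+2 t * t ^+ 2.
  rewrite /flat_exp t0 mulrAC; congr (_ * _).
  by rewrite -[n.+2]addn2 exprD invfM mulfVK// expf_neq0// gt_eqF.
by rewrite ler_wpM2r ?sqr_ge0// flat_exp_le_fact.
Qed.

Lemma is_derive_flat_exp n t :
  is_derive t (1 : R) (flat_exp n) (flat_exp n.+2 t - n%:R * flat_exp n.+1 t).
Proof.
have [t0|t0|<-] := ltgtP 0 t.
- apply: (@near_eq_is_derive R R R (fun u => u ^- n * expR (- u^-1))).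
    near=> u; rewrite /flat_exp ifT//; near: u; exact: lt_nbhsr.
  have tn0 : t != 0 by rewrite gt_eqF.
  have dV : is_derive t (1 : R) (fun u : R => u^-1) (- t ^- 2).
    have := @is_deriveV R id t 1 1 tn0 (is_derive_id _ _).
    by rewrite /GRing.scale /= mulr1.
  have dX := is_deriveX n dV.
  have dE : is_derive t (1 : R) (expR \o - (fun u : R => u^-1))
      (expR (- t^-1) * t ^- 2).
    have dN := is_deriveN dV; rewrite opprK in dN.
    exact: is_derive1_comp.
  have := is_deriveM dX dE.
  rewrite (_ : _ * _ = (fun u : R => u ^- n * expR (- u^-1))); last first.
    by apply/funext => u; rewrite !fctE exprVn.
  move/is_derive_eq; apply; rewrite /flat_exp t0 !fctE /GRing.scale /=.
  rewrite -!exprVn; case: n {dX} => [|n] /=; rewrite ?exprS; ring.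
- rewrite /flat_exp !ltNge !ltW//= mulr0 subr0.
  apply: (@near_eq_is_derive R R R (cst 0)).
    near=> u; rewrite /flat_exp ifN// -leNgt ltW//; near: u; exact: lt_nbhsl.
have -> : flat_exp n.+2 0 - n%:R * flat_exp n.+1 0 = 0.
  by rewrite /flat_exp ltxx mulr0 subr0.
have f0 : flat_exp n 0 = 0 by rewrite /flat_exp ltxx.
(* At the origin the difference quotient is at most (n+2)! |h| in absolute value. *)
suff L : (fun h => h^-1 *: ((flat_exp n \o shift 0) (h *: 1) - flat_exp n 0))
    @ 0^' --> (0 : R).
  by apply: DeriveDef; [apply/cvg_ex; exists 0|exact: cvg_lim].
apply/cvgr0Pnorm_le => e e0.
have C0 : 0 < n.+2`!%:R :> R by rewrite ltr0n fact_gt0.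
near=> h.
have h0 : h != 0 by near: h; exact: nbhs_dnbhs_neq.
rewrite f0 subr0 /= addr0 [_ *: 1]mulr1 normrM normfV.
rewrite ler_pdivrMl ?normr_gt0// ger0_norm ?flat_exp_ge0//.
apply: le_trans (flat_exp_quadratic _ _) _.
rewrite -(real_normK (num_real h)) expr2 mulrCA ler_wpM2l//.
by rewrite -ler_pdivlMl//; near: h; apply: dnbhs0_le; rewrite mulr_gt0 ?invr_gt0.
Unshelve. all: by end_near. Qed.

End FlatExp.

(** * Products and flat exponentials of class C^k in several variables *)

Section SmoothCalculus.
Variables (R : realType) (d : nat) (Omega : set 'rV[R]_d).
Hypothesis openO : open Omega.
Implicit Types f g : 'rV[R]_d -> R.

Lemma CkS k f : Ck Omega k.+1 f -> Ck Omega k f.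
Proof.
elim: k f => [|k IH] f [cf hf]; split=> // j.
by have [df Df] := hf j; split=> //; exact: IH.
Qed.

Lemma CkM k f g : Ck Omega k f -> Ck Omega k g ->
  Ck Omega k (fun x => f x * g x).
Proof.
elim: k f g => [|k IH] f g Cf Cg; have [cf hf] := Cf; have [cg hg] := Cg;
  (split=> [x Ox|//]; first by apply: continuousM; [exact: cf|exact: cg]).
move=> j; have [df Df] := hf j; have [dg Dg] := hg j; split.
  by move=> x Ox; apply: derivableM; [exact: df|exact: dg].
apply: (Ck_eq openO _ (CkD openO (IH _ _ (CkS Cf) Dg) (IH _ _ (CkS Cg) Df))).
by move=> x Ox; exact/esym/(deriveM (df x Ox) (dg x Ox)).
Qed.

Lemma Ck_cst k (a : R) : Ck Omega k (fun=> a).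
Proof.
case: k => [|k]; (split=> [x _|//]; first exact: cst_continuous).
move=> j; split=> [x _|]; first exact: derivable_cst.
by apply: (Ck_eq openO _ (Ck0 openO k)) => x _; rewrite derive_cst.
Qed.

Lemma Ck_prod k (J : Type) (r : seq J) (F : J -> 'rV[R]_d -> R) :
  (forall j, Ck Omega k (F j)) -> Ck Omega k (fun x => \prod_(j <- r) F j x).
Proof.
move=> CF; elim: r => [|j r IH].
  by apply: (Ck_eq openO _ (Ck_cst k 1)) => x _; rewrite big_nil.
by apply: (Ck_eq openO _ (CkM (CF j) IH)) => x _; rewrite big_cons.
Qed.

(** Along the [j]-th axis the argument is affine, with slope [a] if [j == i] and 0 otherwise, which
    reduces the claim to the one-variable chain rule. *)
Lemma is_derive_flat_exp_coord n (a c : R) (i j : 'I_d) (x : 'rV[R]_d) :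
  is_derive x (delta_mx 0 j) (fun y : 'rV[R]_d => flat_exp n (a * y 0 i + c))
   ((j == i)%:R * a * (flat_exp n.+2 (a * x 0 i + c)
       - n%:R * flat_exp n.+1 (a * x 0 i + c))).
Proof.
pose l (h : R) := ((j == i)%:R * a) * h + (a * x 0 i + c).
have dl : is_derive (0 : R) (1 : R) l ((j == i)%:R * a).
  by rewrite /l; apply: is_derive_eq; rewrite /GRing.scale /=; ring.
have fl : is_derive (l 0) (1 : R) (flat_exp n)
    (flat_exp n.+2 (l 0) - n%:R * flat_exp n.+1 (l 0)).
  exact: is_derive_flat_exp.
have l0 : l 0 = a * x 0 i + c by rewrite /l mulr0 add0r.
have := is_derive1_comp fl dl; rewrite l0 => h.
have E : (fun h : R => flat_exp n (a * (h *: delta_mx 0 j + x : 'rV[R]_d) 0 i + c))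
    = flat_exp n \o l.
  apply/funext => u /=; rewrite !mxE eqxx /= /l; congr flat_exp.
  by rewrite (eq_sym i) /GRing.scale /=; ring.
have [D V] := h.
apply: DeriveDef; first by apply/derivable1P; rewrite E.
rewrite mulrC -V /derive -E; congr (lim (_ @ 0^')).
apply/funext => u /=.
by rewrite addr0 scale0r add0r [_ *: 1]mulr1.
Qed.

Lemma Ck_flat_exp_coord k n (a c : R) (i : 'I_d) :
  Ck Omega k (fun x : 'rV[R]_d => flat_exp n (a * x 0 i + c)).
Proof.
have cont m : continuous (fun x : 'rV[R]_d => flat_exp m (a * x 0 i + c)).
  move=> x; apply: (@continuous_comp _ _ _ (fun y : 'rV[R]_d => a * y 0 i + c)).
    apply: continuousD; last exact: cst_continuous.
    by apply: continuousM; [exact: cst_continuous|exact: coord_continuous].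
  apply/differentiable_continuous/derivable1_diffP.
  by have [] := is_derive_flat_exp m (a * x 0 i + c).
(* [n] stays general because the derivative involves the indices n+1 and n+2. *)
elim: k n => [|k IH] n; (split=> [x _|//]; first exact: cont).
move=> j; split=> [x _|].
  by have [] := is_derive_flat_exp_coord n a c i j x.
pose D m := fun x : 'rV[R]_d => flat_exp m (a * x 0 i + c).
have := CkD openO (CkZ openO ((j == i)%:R * a) (IH n.+2))
  (CkZ openO (- ((j == i)%:R * a) * n%:R) (IH n.+1)).
apply: (Ck_eq openO) => x _.
have [_ ->] := is_derive_flat_exp_coord n a c i j x.
by ring.
Qed.

End SmoothCalculus.

(** * Bumps on cubes and their linear independence *)

Section Bump.
Variables (R : realType) (d : nat).
Implicit Types a x : 'rV[R]_d.

(** The coefficients 1 and -1 give every factor the affine shape handled by [Ck_flat_exp_coord]. *)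
Definition bump a (r : R) x : R :=
  \prod_(i < d) (flat_exp 0 (1 * x 0 i + (r - a 0 i)) *
                 flat_exp 0 (- 1 * x 0 i + (r + a 0 i))).

Lemma bump_neq0 a r x :
  (bump a r x != 0) = [forall i, `|x 0 i - a 0 i| < r].
Proof.
have E i : (flat_exp 0 (1 * x 0 i + (r - a 0 i)) *
    flat_exp 0 (- 1 * x 0 i + (r + a 0 i)) != 0) = (`|x 0 i - a 0 i| < r).
  have neq0 u : (flat_exp 0 u != 0) = (0 < u :> R).
    by rewrite -(flat_exp_gt0 0) lt0r flat_exp_ge0 andbT.
  rewrite mulf_eq0 negb_or !neq0 ltr_distl; congr (_ && _).
    by apply/idP/idP; lra.
  by apply/idP/idP; lra.
apply/idP/forallP => [|h].
  by move=> /prodf_neq0 h i; rewrite -E; exact: h.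
by apply/prodf_neq0 => i _; rewrite E.
Qed.

Lemma Ck_bump (Omega : set 'rV[R]_d) k a r : open Omega -> Ck Omega k (bump a r).
Proof.
by move=> openO; apply: Ck_prod => // i; apply: CkM => //;
  exact: Ck_flat_exp_coord.
Qed.

Lemma box_compact a r :
  compact [set x : 'rV[R]_d | forall i, `|x 0 i - a 0 i| <= r].
Proof.
have := @rV_compact R d (fun i => `[a 0 i - r, a 0 i + r]%classic).
move=> /(_ (fun i => @segment_compact _ _ _)); congr compact.
apply/seteqP; split=> x /= h i; have := h i; rewrite in_itv /= ler_distl //.
Qed.

Variables (Omega : set 'rV[R]_d) (openO : open Omega).

(** The support lies in the closed cube of radius [r], which is compact and, as [r < e], inside the
    sup-norm ball of radius [e]. *)
Lemma bump_test_fun a r e : 0 < r < e -> ball a e `<=` Omega ->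
  exists phi : test_fun openO, forall x, phi x = (bump a r x)%:C%C.
Proof.
move=> /andP[r0 re] aeO; pose f x : R[i] := (bump a r x)%:C%C.
have boxO : [set x : 'rV[R]_d | forall i, `|x 0 i - a 0 i| <= r] `<=` Omega.
  move=> x xr; apply: aeO; split; first exact: (lt_trans r0).
  by move=> i j; rewrite ord1 /ball /= distrC (le_lt_trans (xr j)).
have fbox (x : 'rV[R]_d) : f x != 0 -> forall i, `|x 0 i - a 0 i| <= r.
  rewrite /f eq_complex /= eqxx andbT bump_neq0 => /forallP h i.
  exact/ltW.
have smf : f \in smooth_funs openO.
  apply/asboolP; split=> [k|x nOx]; first by split; [exact: Ck_bump|exact: Ck0].
  by apply: contra_notP nOx => /eqP fx; apply: boxO; exact: fbox.
have cbox := @box_compact a r.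
have sf : supp f `<=` [set x : 'rV[R]_d | forall i, `|x 0 i - a 0 i| <= r].
  rewrite [X in _ `<=` X](closure_id _).1; first exact: closure_subset.
  by apply: compact_closed cbox; exact: norm_hausdorff.
have tf : SmoothFun smf \in @test_funs R d Omega openO.
  apply/asboolP; split; last exact: subset_trans sf _.
  by apply: subclosed_compact cbox sf; exact: closed_closure.
by exists (TestFun tf).
Qed.

(** Induction on the number of bumps, removing the one of largest radius. In dimension 0 every bump
    is the empty product 1, whence [0 < d]. *)
Lemma free_bumps a e (J : choiceType) (rad : J -> R) : (0 < d)%N ->
  ball a e `<=` Omega -> injective rad -> (forall j, 0 < rad j < e) ->
  exists v : J -> test_fun openO, free_family v.
Proof.
move=> d0 aeO inj_rad rade.
pose v j := projT1 (cid (bump_test_fun (rade j) aeO)).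
have vE j : forall x, v j x = (bump a (rad j) x)%:C%C.
  exact: projT2 (cid (bump_test_fun (rade j) aeO)).
exists v => s; move: {2}(size s) (erefl (size s)) => n.
elim: n s => [|n IH] s sn c us s0; first by move/size0nil: sn => ->.
have [m ms mmax] : exists2 m, m \in s & forall j, j \in s -> rad j <= rad m.
  move: sn {us s0}; elim: s n {IH} => // j [|k s] IHs n _.
    by exists j; rewrite ?mem_head// => i; rewrite inE => /eqP ->.
  have [m ms mmax] := IHs _ erefl.
  have [jm|mj] := leP (rad j) (rad m).
    exists m; first by rewrite inE ms orbT.
    by move=> i; rewrite inE => /predU1P[->//|/mmax].
  exists j; first exact: mem_head.
  by move=> i; rewrite inE => /predU1P[->//|/mmax/le_lt_trans/(_ mj)/ltW].
(* On the sphere of radius t around a only the largest bump is nonzero. *)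
pose t := \big[Num.max/0]_(j <- s | j != m) rad j.
have t0 : 0 <= t by exact: bigmax_ge_id.
have tm : t < rad m.
  rewrite /t big_seq_cond; apply: bigmax_lt => [|j /andP[js jm]].
    by have /andP[] := rade m.
  by rewrite lt_neqAle mmax// andbT (inj_eq inj_rad).
pose p : 'rV[R]_d := \row_i (a 0 i + t).
have pE j : (v j p != 0) = (t < rad j).
  rewrite vE eq_complex /= eqxx andbT bump_neq0.
  have pt i : `|p 0 i - a 0 i| = t by rewrite mxE addrAC subrr add0r ger0_norm.
  by apply/forallP/idP => [/(_ (Ordinal d0))|tj i]; rewrite pt.
have ev : \sum_(j <- s) c j * v j p = 0.
  have -> : \sum_(j <- s) c j * v j p = (\sum_(j <- s) c j *: v j) p.
    by elim/big_ind2: _ => // x y u w -> ->.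
  by rewrite s0.
have cm : c m = 0.
  move: ev; rewrite (bigD1_seq m)//= big_seq_cond big1 ?addr0; last first.
    move=> j /andP[js jm]; apply/eqP; rewrite mulf_eq0; apply/orP; right.
    by rewrite -[_ == 0]negbK pE -leNgt; exact: le_bigmax_seq.
  by move/eqP; rewrite mulf_eq0 => /orP[/eqP//|]; rewrite (negPf (_ : _ != 0)) ?pE.
move=> j js; have [->//|jm] := eqVneq j m.
apply: (IH (rem m s)); rewrite ?rem_uniq ?size_rem ?sn//.
  by move: s0; rewrite (big_rem m)//= cm scale0r add0r.
by rewrite mem_rem_uniq// inE jm.
Qed.

End Bump.

(** * Coding by subsets and real numbers *)

Section LargeDual.
Variables (K : fieldType) (V : lmodType K) (T : choiceType).

Definition consistent (S : T -> bool) (l : seq (T * bool)) : bool :=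
  all (fun p => S p.1 == p.2) l.

(** One point at which a listed set differs from [S] gives a condition that rules this set out. *)
Lemma consistent_separate (S : T -> bool) (s : seq (T -> bool)) :
  exists l, consistent S l /\ forall S', S' \in s -> S' <> S -> ~~ consistent S' l.
Proof.
elim: s => [|S1 s [l [Sl sepl]]]; first by exists [::].
have [->|/eqP S1S] := eqVneq S1 S.
  exists l; split=> // S'; rewrite inE => /predU1P[->//|]; exact: sepl.
have [t S1t] : exists t, S1 t <> S t.
  by apply/existsNP => /funext.
exists ((t, S t) :: l); split; first by rewrite /consistent /= eqxx.
move=> S'; rewrite inE /consistent /= => /predU1P[-> _|S's S'S].
  by rewrite (negPf (_ : S1 t != S t))//; apply/eqP.
by rewrite negb_and sepl ?orbT.
Qed.

(** A vanishing combination of the functionals is evaluated at [v l], where [l] is satisfied by only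
    one of the finitely many sets involved; this isolates its coefficient. *)
Lemma free_alg_dual (J : choiceType) (code : J -> T -> bool)
    (v : seq (T * bool) -> V) : injective code -> free_family v ->
  exists L : J -> alg_dual V, free_family L.
Proof.
move=> inj_code freev.
have exL j := linear_extension_family (W := K^o)
  (fun l => (consistent (code j) l)%:R) freev.
have linL j : (projT1 (cid (exL j)) : V -> K^o) \in @linear_forms K V.
  by apply/asboolP; exact: linearP.
pose L j := AlgDual (linL j); exists L => s c us s0 j js.
have [l [jl sepl]] := consistent_separate (code j) (map code s).
have Lv i : L i (v l) = (consistent (code i) l)%:R :> K.
  exact: (projT2 (cid (exL i))).
have : \sum_(i <- s) c i * L i (v l) = 0.
  have -> : \sum_(i <- s) c i * L i (v l) =
      (\sum_(i <- s) c i *: L i) (v l).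
    by elim/big_ind2: _ => // x y u w -> ->.
  by rewrite s0.
rewrite (bigD1_seq j)// Lv jl mulr1 big_seq_cond big1; first by rewrite [LHS]addr0.
move=> i /andP[is_ ij]; rewrite Lv (negPf (sepl _ _ _)) ?mulr0//.
  exact: map_f.
by move/inj_code/eqP; rewrite (negPf ij).
Qed.

End LargeDual.

(** * Base 3 expansions and the coding of lists by real numbers *)

Section Ternary.
Variable R : realType.
Implicit Types S : nat -> bool.

(* Digits 0 and 1 in base 3: the tail after position n is at most half of the
   weight of digit n, so the expansion is unique. *)
Definition ternary_sum S (n : nat) : R := \sum_(k < n) (S k)%:R * 3^-1 ^+ k.

Definition ternary S : R := sup (range (ternary_sum S)).

Lemma ternary_sumS S n :
  ternary_sum S n.+1 = ternary_sum S n + (S n)%:R * 3^-1 ^+ n.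
Proof. by rewrite /ternary_sum big_ord_recr. Qed.

(** The constant is the full geometric tail: the sum of 3^-k over k >= n is 3/2 * 3^-n. *)
Lemma ternary_sum_le S n m :
  ternary_sum S m <= ternary_sum S n + 3 / 2 * 3^-1 ^+ n.
Proof.
have p k : 0 < 3^-1 ^+ k :> R by rewrite exprn_gt0// invr_gt0.
have mono k : ternary_sum S k <= ternary_sum S k.+1.
  by rewrite ternary_sumS lerDl mulr_ge0// ltW.
have [mn|/ltnW nm] := leqP m n.
  apply: (@le_trans _ _ (ternary_sum S n)).
    by have /nondecreasing_seqP := mono; exact.
  by rewrite lerDl mulr_ge0// ltW.
have -> : m = (n + (m - n))%N by rewrite subnKC.
(* For the induction the bound is sharpened to the exact finite geometric sum. *)
suff : ternary_sum S (n + (m - n)) <=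
    ternary_sum S n + 3 / 2 * (3^-1 ^+ n - 3^-1 ^+ (n + (m - n))).
  by have := p (n + (m - n))%N; lra.
elim: (m - n)%N => [|k IH]; first by rewrite addn0 subrr mulr0 addr0.
rewrite addnS ternary_sumS exprS; have := p (n + k)%N.
by case: (S _); rewrite /= ?mul1r ?mul0r; lra.
Qed.

Lemma ternary_bounds S n :
  ternary_sum S n <= ternary S <= ternary_sum S n + 3 / 2 * 3^-1 ^+ n.
Proof.
apply/andP; split.
  apply: ub_le_sup; last by exists n.
  by exists (ternary_sum S n + 3 / 2 * 3^-1 ^+ n) => _ [m _ <-];
    exact: ternary_sum_le.
apply: ge_sup; first by exists (ternary_sum S 0); exists 0%N.
by move=> _ [m _ <-]; exact: ternary_sum_le.
Qed.

Lemma ternary_inj : injective ternary.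
Proof.
move=> S S' SS'; apply: contrapT => neq.
have exn : exists n, S n != S' n.
  by apply: contrapT => /forallNP h; apply: neq; apply/funext => n;
    apply/eqP; have /negP := h n; rewrite negbK.
have [n Sn nmin] := ex_minnP exn.
have sumE : ternary_sum S n = ternary_sum S' n.
  apply: eq_bigr => k _; congr ((nat_of_bool _)%:R * _).
  by apply/eqP; apply: contraT => /nmin; rewrite leqNgt ltn_ord.
have p : 0 < 3^-1 ^+ n :> R by rewrite exprn_gt0// invr_gt0.
have := ternary_bounds S n.+1; have := ternary_bounds S' n.+1.
rewrite SS' !ternary_sumS sumE exprS => /andP[l1 u1] /andP[l2 u2].
by move: Sn l1 u1 l2 u2; case: (S n); case: (S' n) => //= _;
  rewrite mul0r mul1r; lra.
Qed.

Lemma nat_bool_embeds_interval (e : R) : 0 < e ->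
  exists f : (nat -> bool) -> R, injective f /\ forall S, 0 < f S < e.
Proof.
(* [ternary S] lies between 0 and 3/2, so the factor of [e] lies between 1/4 and 5/8. *)
move=> e0; exists (fun S => e * ((1 + ternary S) / 4)); split=> [S S'|S].
  by move/(mulfI (lt0r_neq0 e0)) => h; apply: ternary_inj; lra.
have := ternary_bounds S 0; rewrite /ternary_sum big_ord0 expr0 => /andP[? ?].
rewrite mulr_gt0 ?divr_gt0 ?ltr_pwDl//= gtr_pMr//; lra.
Qed.

(** Each real entry is recorded by its lower Dedekind cut, tagged with its position and its natural
    number; a list becomes a subset of a countable set. *)
Definition cut_code (l : seq (R * nat)) (p : nat * rat * nat) : bool :=
  [&& (p.1.1 < size l)%N, ratr p.1.2 < (nth (0, 0%N) l p.1.1).1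
    & p.2 == (nth (0, 0%N) l p.1.1).2].

Lemma cut_code_inj : injective cut_code.
Proof.
move=> l l' ll'.
have below (x : R) : exists q : rat, ratr q < x.
  have [|q] := @rat_in_itvoo R (x - 1) x; first lra.
  by rewrite in_itv /= => /andP[_ qx]; exists q.
(* If [l1] were longer, a rational below its entry at position [size l2] would be recorded for [l1],
   while [l2] records nothing at that position. *)
have sz l1 l2 : cut_code l1 = cut_code l2 -> (size l1 <= size l2)%N.
  move=> E; rewrite leqNgt; apply/negP => lt21.
  have [q qx] := below (nth (0, 0%N) l1 (size l2)).1.
  have := congr1 (@^~ (size l2, q, (nth (0, 0%N) l1 (size l2)).2)) E.
  by rewrite /cut_code /= lt21 qx eqxx ltnn.
have szE : size l = size l' by apply/eqP; rewrite eqn_leq !sz.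
apply: (@eq_from_nth _ (0, 0%N)) => // k kl.
have kl' : (k < size l')%N by rewrite -szE.
have E q m := congr1 (@^~ (k, q, m)) ll'.
rewrite /cut_code /= in E.
move: E; rewrite kl kl' /=.
case: (nth _ l k) => x m; case: (nth _ l' k) => x' m' /= E.
have mE : m = m'.
  have [q qx] := below x.
  by have := E q m; rewrite qx eqxx /= => /esym/andP[_ /eqP].
subst m'; congr pair.
have [/rat_in_itvoo[q]|/rat_in_itvoo[q]|//] := ltgtP x x'.
  rewrite in_itv /= => /andP[xq qx']; have := E q m.
  by rewrite qx' ltNge (ltW xq) eqxx.
rewrite in_itv /= => /andP[xq qx']; have := E q m.
by rewrite qx' [X in _ = X && _]ltNge (ltW xq) eqxx.
Qed.

(** Supplies distinct bump radii. Lists over [T * Q * bool] are mapped to lists over [R * nat], then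
    by [cut_code] to subsets of a countable set, then to the interval. *)
Lemma seq_embeds_interval (T : Type) (Q : countType) (f : T -> R) (e : R) :
  injective f -> 0 < e ->
  exists g : seq (T * Q * bool) -> R, injective g /\ forall l, 0 < g l < e.
Proof.
move=> inj_f /nat_bool_embeds_interval[h [inj_h he]].
pose r (t : T * Q * bool) := (f t.1.1, pickle (t.1.2, t.2)).
have inj_r : injective r.
  move=> [[t q] b] [[t' q'] b'] [/inj_f -> /(pcan_inj pickleK)[-> ->]] //.
pose c l n := if unpickle n is Some p then cut_code (map r l) p else false.
exists (h \o c); split=> [l l' /inj_h cc|l]; last exact: he.
apply: (inj_map inj_r); apply: cut_code_inj; apply/funext => p.
by have := congr1 (@^~ (pickle p)) cc; rewrite /c pickleK.
Qed.

End Ternary.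

(** * Coding generalized distributions by subsets *)

Section SmoothCode.
Variables (R : realType) (d : nat).

(** Density of the rational points. Continuity is asked at [x] only, since an extension by zero may
    be discontinuous at the boundary. *)
Lemma eq0_on_rational_points (h : 'rV[R]_d -> R) x : {for x, continuous h} ->
  (forall q : 'rV[rat]_d, h (map_mx ratr q) = 0) -> h x = 0.
Proof.
move=> ch hq; apply: contrapT => /eqP hx.
have : nbhs x [set y | h y != 0].
  by apply: (ch [set r | r != 0]); apply: open_nbhs_nbhs; split; [exact: open_neq|].
move=> /nbhs_ballP[e /= e0 he].
have exq i : exists q : rat, `|x 0 i - ratr q| < e.
  have [|q] := @rat_in_itvoo R (x 0 i - e) (x 0 i + e); first lra.
  by rewrite in_itv /= => qx; exists q; rewrite distrC ltr_distl.
pose q : 'rV[rat]_d := \row_i projT1 (cid (exq i)).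
have /he /= : ball x e (map_mx ratr q : 'rV[R]_d).
  split=> // i j; rewrite ord1 !mxE; exact: (projT2 (cid (exq j))).
by rewrite hq eqxx.
Qed.

Variables (Omega : set 'rV[R]_d) (openO : open Omega).

(** These are the lower Dedekind cuts of the real and imaginary parts at rational points. *)
Definition smooth_code (f : smooth_fun openO) (p : 'rV[rat]_d * rat * bool) :=
  let z := f (map_mx ratr p.1.1) in
  ratr p.1.2 < if p.2 then complex.Re z else complex.Im z.

(** The cuts give the values at rational points, continuity those on [Omega]; elsewhere both
    functions are zero. *)
Lemma smooth_code_inj : injective smooth_code.
Proof.
move=> f g fg.
have cutE (u w : R) : (forall r : rat, (ratr r < u) = (ratr r < w)) -> u = w.
  move=> E; have [/rat_in_itvoo[r]|/rat_in_itvoo[r]|//] := ltgtP u w;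
    rewrite in_itv /= => /andP[h1 h2]; have := E r.
    by rewrite h2 ltNge (ltW h1).
  by rewrite h2 [RHS]ltNge (ltW h1).
have E q r b := congr1 (@^~ (q, r, b)) fg.
have ReE q : complex.Re (f (map_mx ratr q)) = complex.Re (g (map_mx ratr q)).
  by apply: cutE => r; exact: (E q r true).
have ImE q : complex.Im (f (map_mx ratr q)) = complex.Im (g (map_mx ratr q)).
  by apply: cutE => r; exact: (E q r false).
apply/val_inj/funext => x /=.
have [Ox|nOx] := pselect (Omega x); last first.
  have /asboolP[_ f0] := valP f; have /asboolP[_ g0] := valP g.
  exact: etrans (f0 x nOx) (esym (g0 x nOx)).
have [cfr cfi] := smooth_fun_continuous f Ox.
have [cgr cgi] := smooth_fun_continuous g Ox.
apply/eqP; rewrite eq_complex; apply/andP; split; rewrite -subr_eq0.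
  apply/eqP; apply: (eq0_on_rational_points (continuousB cfr cgr)) => q.
  by rewrite !fctE ReE subrr.
apply/eqP; apply: (eq0_on_rational_points (continuousB cfi cgi)) => q.
by rewrite !fctE ImE subrr.
Qed.

(** There are two quotients to undo: the inner [repr] chooses an element of the ultrapower, the
    outer one a family of smooth functions. *)
Lemma gen_distribution_code (I : Type) (U : set_system I) (FU : Filter U) :
  exists code : gen_distribution openO U ->
    I * ('rV[rat]_d * rat * bool) -> bool, injective code.
Proof.
exists (fun w p => smooth_code (repr (repr w) p.1) p.2) => w w' E.
apply: (can_inj reprK); apply: (can_inj reprK); apply/funext => i.
apply: smooth_code_inj; apply/funext => p.
by have := congr1 (fun h => h (i, p)) E.
Qed.

End SmoothCode.

Theorem mainTheorem6 (gch : GCH) (R : realType) (d : nat) (d_gt0 : (0 < d)%N)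
    (Omega : set 'rV[R]_d) (openO : open Omega) (Omega_neq0 : Omega !=set0)
    (I : Type) (cardI : [set: I] #= [set: R])
    (cplus : Type) (cplus_succ : successor_cardinal R cplus)
    (U : set_system I) (ultraU : UltraFilter U) (freeU : free_filter U)
    (incompleteU : countably_incomplete U) (goodU : good_filter cplus U) :
  exists F : {linear gen_distribution openO U -> alg_dual (test_fun openO)},
    injective F.
Proof.
have [f inj_f] : exists f : I -> R, injective f.
  have := cardI; rewrite card_eq_le => /andP[/pcard_injP[f inj_f] _].
  by exists f => i j; apply: inj_f; rewrite in_setT.
have [a Oa] := Omega_neq0.
have /nbhs_ballP[e /= e0 aeO] : nbhs a Omega by exact: open_nbhs_nbhs.
(* One radius for each list of conditions; [{classic I}] provides the choice structure that the
   indices of a free family must carry. *)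
have [g [inj_g ge]] :=
  @seq_embeds_interval R {classic I} ('rV[rat]_d * rat * bool)%type f e inj_f e0.
have [v freev] := free_bumps openO d_gt0 aeO inj_g ge.
have [code inj_code] := gen_distribution_code openO (_ : Filter U).
(* The functionals are indexed by the generalized distributions themselves, as [linear_injection]
   requires. *)
have [L freeL] := free_alg_dual (T := ({classic I} * ('rV[rat]_d * rat * bool))%type)
  inj_code freev.
exact: linear_injection freeL.
Qed.
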